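(* Fix an odd prime $p$. There are constants $c_p>0$ and $r_0(p)<\infty$ such that, for every $h=2m\ge2$ and every $r\ge\max\{h+1,r_0(p)\}$, the half-lazy PA-PRA walk $Q$ on $V_r(\mathsf H)$ (with $\dim W=h$) satisfies \[ \tau_{\mathrm{mix}}(Q)\ge c_p\max\left\{r\log r,\ \frac{r(h+1)}{\log(er)}\right\}. \]
   Context: Let $p$ be an odd prime, $W$ a vector space of dimension $h=2m$ over $\mathbb F_p$ with a nondegenerate alternating bilinear form $\omega$. The Heisenberg group $\mathsf H=W\times\mathbb F_p$ has multiplication $(v,z)(w,t)=(v+w,\,z+t+\tfrac12\omega(v,w))$, where $\tfrac12$ is the inverse of $2$ in $\mathbb F_p$. Let $V_r(\mathsf H)=\{(g_1,\dots,g_r)\in\mathsf H^r:\langle g_1,\dots,g_r\rangle=\mathsf H\}$ and $\pi$ the uniform measure on it. For distinct $i,j\in[r]$ and $a\in\mathbb F_p$, $T^R_{j\to i,a}$ replaces $g_i$ by $g_ig_j^a$ and $T^L_{j\to i,a}$ replaces $g_i$ by $g_j^ag_i$. The PA-PRA kernel is $Pf(g)=\frac1{2pr(r-1)}\sum_{i\ne j}\sum_{a\in\mathbb F_p}[f(T^R_{j\to i,a}g)+f(T^L_{j\to i,a}g)]$ and $Q=\frac12(I+P)$. $\tau_{\mathrm{mix}}(Q)=\min\{t\ge0:\max_x\|Q^t(x,\cdot)-\pi\|_{\mathrm{TV}}\le1/4\}$. *)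

(* Defs.v *)
From HB Require Import structures.
From mathcomp Require Import all_boot all_order all_algebra.
From mathcomp Require Import Rstruct.
From Stdlib Require Import Reals.
Set Implicit Arguments. Unset Strict Implicit. Unset Printing Implicit Defensive.
Import GRing.Theory Num.Theory.

Local Open Scope ring_scope.

Section Heis.
Variables (p h : nat).

Definition Heis := ('rV['F_p]_h * 'F_p)%type.

Definition symplectic_form (om : 'rV['F_p]_h -> 'rV['F_p]_h -> 'F_p) : Prop :=
  [/\ (forall (a : 'F_p) u v w, om (a *: u + v) w = a * om u w + om v w),
      (forall (a : 'F_p) u v w, om w (a *: u + v) = a * om w u + om w v),
      (forall v, om v v = 0) &
      (forall v, (forall w, om v w = 0) -> v = 0)].

Variable om : 'rV['F_p]_h -> 'rV['F_p]_h -> 'F_p.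

Definition hmul (x y : Heis) : Heis :=
  (x.1 + y.1, x.2 + y.2 + 2%:R^-1 * om x.1 y.1).
Definition hone : Heis := (0, 0).
Definition hinv (x : Heis) : Heis := (- x.1, - x.2).

Fixpoint hpow (g : Heis) (n : nat) : Heis :=
  if n is n'.+1 then hmul (hpow g n') g else hone.

Definition generates (r : nat) (g : {ffun 'I_r -> Heis}) : bool :=
  [forall S : {set Heis},
     [&& [forall i, g i \in S], hone \in S,
         [forall x in S, hinv x \in S] &
         [forall x in S, forall y in S, hmul x y \in S]]
     ==> (S == setT)].

Variable r : nat.
Definition state := {ffun 'I_r -> Heis}.

Definition Vr : {set state} := [set g : state | generates g].

Definition TR (j i : 'I_r) (a : 'F_p) (g : state) : state :=
  [ffun k => if k == i then hmul (g i) (hpow (g j) (val a)) else g k].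
Definition TL (j i : 'I_r) (a : 'F_p) (g : state) : state :=
  [ffun k => if k == i then hmul (hpow (g j) (val a)) (g i) else g k].

Definition Pker (x y : state) : R :=
  (2 * p%:R * r%:R * (r%:R - 1))^-1 *
  \sum_(i : 'I_r) \sum_(j : 'I_r | j != i) \sum_(a : 'F_p)
     (((TR j i a x == y)%:R : R) + ((TL j i a x == y)%:R : R)).

Definition Qker (x y : state) : R :=
  2^-1 * ((x == y)%:R + Pker x y).

Fixpoint Qpow (t : nat) (x : state) : state -> R :=
  if t is t'.+1 then fun y => \sum_(z : state) Qpow t' x z * Qker z y
  else fun y => (x == y)%:R.

Definition piV (y : state) : R := (y \in Vr)%:R / (#|Vr|)%:R.

Definition tv (mu nu : state -> R) : R := 2^-1 * \sum_(y : state) `|mu y - nu y|.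

(* t is in the set defining tau_mix(Q) *)
Definition mixed_at (t : nat) : Prop :=
  forall x, x \in Vr -> tv (Qpow t x) piV <= 4^-1.

End Heis.

(* Main.v *)
(* Let [f g] be the number of entries of [g] whose image under a fixed nonzero
   linear functional of W is nonzero.  A move copies a multiple of [g j] onto
   [g i], so it increases [f] only if [g j] is counted, whence
   [Q f <= (1 + 1/(2r)) f].  From a start with [f = 1], the mean of [f] at time t is
   at most [(1 + 1/(2r))^t], whereas under pi it is at least [r/2]; mixing thus
   forces [r <= 4 (1 + 1/(2r))^t], which is the [r log r] bound.  For the other
   bound, [Q^t x] is carried by at most [(2 p r^2)^t] states, while
   [|V_r|^2 p^h >= p^(r(h+1))]. *)
Require Import Defs.
From HB Require Import structures.
From mathcomp Require Import all_boot all_order all_algebra.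
From mathcomp Require Import Rstruct ring lra zify.

Set Implicit Arguments. Unset Strict Implicit. Unset Printing Implicit Defensive.
Import Order.TTheory GRing.Theory Num.Theory.
Local Open Scope ring_scope.

(** * The Heisenberg group, generating tuples and the size of V_r *)

Section Heisenberg.
Variables (p h : nat) (om : 'rV['F_p]_h -> 'rV['F_p]_h -> 'F_p).
Hypothesis om_symp : symplectic_form om.

Lemma form0r v : om v 0 = 0.
Proof.
have [_ oR _ _] := om_symp.
by have := oR (-1) 0 0 v; rewrite scaler0 addr0 mulN1r addNr.
Qed.

Lemma formDl u v w : om (u + v) w = om u w + om v w.
Proof. by have [oL _ _ _] := om_symp; rewrite -[u]scale1r oL mul1r scale1r. Qed.

Lemma formDr u v w : om w (u + v) = om w u + om w v.
Proof. by have [_ oR _ _] := om_symp; rewrite -[u]scale1r oR mul1r scale1r. Qed.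

Lemma formNr v w : om v (- w) = - om v w.
Proof. by apply/eqP; rewrite -addr_eq0 -formDr addNr form0r. Qed.

Lemma form0l v : om 0 v = 0.
Proof.
have [oL _ _ _] := om_symp.
by have := oL (-1) 0 0 v; rewrite scaler0 addr0 mulN1r addNr.
Qed.

Lemma formNl v w : om (- v) w = - om v w.
Proof. by apply/eqP; rewrite -addr_eq0 -formDl addNr form0l. Qed.

Lemma formxx v : om v v = 0.
Proof. by have [_ _ + _] := om_symp; exact. Qed.

Lemma form_neq0 : (0 < h)%N -> exists v w, om v w != 0.
Proof.
move=> h_gt0; have [_ _ _ nondeg] := om_symp.
have [/existsP[v /existsP[w vw]]|] := boolP [exists v, exists w, om v w != 0].
  by exists v, w.
rewrite negb_exists => /forallP om0.
have: const_mx 1 = 0 :> 'rV['F_p]_h.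
  apply: nondeg => w; have := om0 (const_mx 1).
  by rewrite negb_exists => /forallP /(_ w); rewrite negbK => /eqP.
move/rowP/(_ (Ordinal h_gt0)); rewrite !mxE => /eqP.
by rewrite oner_eq0.
Qed.

Lemma hmulxx1 (x : Heis p h) : hmul om x (hone p h) = x.
Proof. by case: x => v z; rewrite /hmul /= form0r mulr0 !addr0. Qed.

Lemma hmulK (x y : Heis p h) : hmul om (hmul om x y) (hinv y) = x.
Proof.
case: x y => [v z] [w t]; rewrite /hmul /hinv /= formNr formDl formxx.
by congr pair; [rewrite addrK | ring].
Qed.

(** The left side is the commutator of [x] and [y]. Each inner product contributes half of
    [om x.1 y.1], and the outer one contributes nothing because [om] is alternating. *)
Lemma hcomm (x y : Heis p h) : (2%:R : 'F_p) != 0 ->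
  hmul om (hmul om x y) (hmul om (hinv x) (hinv y)) = (0, om x.1 y.1).
Proof.
move=> n2; case: x y => [v z] [w t]; rewrite /hmul /hinv /=.
rewrite -opprD !(formNr, formNl) formxx; congr pair; first by rewrite subrr.
by field.
Qed.

Lemma hpow1 (x : Heis p h) n : (hpow om x n).1 = x.1 *+ n.
Proof. by elim: n => [|n IHn] /=; rewrite ?mulr0n // IHn mulrSr. Qed.

Lemma hpow_central (z : 'F_p) n : hpow om (0, z) n = (0, z *+ n).
Proof.
elim: n => [|n IHn] //=.
by rewrite IHn /hmul /= form0r mulr0 !addr0 mulrSr.
Qed.

Definition subgroupb (S : {set Heis p h}) : bool :=
  [&& hone p h \in S, [forall x in S, hinv x \in S] &
      [forall x in S, forall y in S, hmul om x y \in S]].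

Lemma subgroupP (S : {set Heis p h}) :
  reflect [/\ hone p h \in S, {in S, forall x, hinv x \in S} &
              {in S &, forall x y, hmul om x y \in S}] (subgroupb S).
Proof.
apply: (iffP and3P) => [[S1 /forall_inP SV /forall_inP SM]|[S1 SV SM]].
  by split=> // x y xS yS; move/forall_inP: (SM x xS); apply.
split=> //; apply/forall_inP => x xS; first exact: SV.
by apply/forall_inP => y yS; apply: SM.
Qed.

Lemma generatesP (r : nat) (g : {ffun 'I_r -> Heis p h}) :
  reflect (forall S : {set Heis p h}, subgroupb S ->
             (forall i, g i \in S) -> S = setT)
          (generates om g).
Proof.
apply: (iffP forallP) => [gen S Ssub gS | gen S].
  by apply/eqP/(implyP (gen S)); rewrite -/(subgroupb S) Ssub andbT; apply/forallP.
apply/implyP => /andP[/forallP gS Ssub]; apply/eqP; exact: gen.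
Qed.

Lemma subgroup_hpow S x n : subgroupb S -> x \in S -> hpow om x n \in S.
Proof.
move=> /subgroupP[S1 _ SM] xS.
by elim: n => [|n IHn] //=; apply: SM.
Qed.

Hypotheses (p_pr : prime p) (p_odd : odd p) (h_gt0 : (0 < h)%N).

Lemma two_neq0 : (2%:R : 'F_p) != 0.
Proof.
rewrite -(dvdn_pcharf (pchar_Fp p_pr)).
apply: contraL p_odd => /(@dvdn_leq p 2 isT) p_le2.
by have -> : p = 2%N by apply/eqP; rewrite eqn_leq p_le2 prime_gt1.
Qed.

Lemma FpE (a : 'F_p) : ((val a)%:R : 'F_p) = a.
Proof. exact: natr_Zp. Qed.

(** Lifts to [S] of two vectors with [om v w != 0] have a nonzero central commutator, whose powers
    fill the centre. A subgroup that contains the centre and maps onto W is the whole group. *)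
Lemma subgroup_full (S : {set Heis p h}) : subgroupb S ->
  (forall v, exists z, (v, z) \in S) -> S = setT.
Proof.
move=> Ssub Sv; have [S1 SV SM] := subgroupP _ Ssub.
have [v [w vw]] := form_neq0 h_gt0.
have [[z1 S1z] [z2 S2z]] := (Sv v, Sv w).
have central c : (0, c) \in S.
  have := SM _ _ (SM _ _ S1z S2z) (SM _ _ (SV _ S1z) (SV _ S2z)).
  rewrite hcomm ?two_neq0 //= => /(subgroup_hpow (val (c / om v w)) Ssub).
  by rewrite hpow_central -mulr_natr FpE mulrC divfK.
apply/setP => -[x z]; rewrite inE; have [z' Sz'] := Sv x.
have := SM _ _ Sz' (central (z - z')).
by rewrite /hmul /= form0r mulr0 !addr0 addrC subrK.
Qed.

(** The first [h] vectors form a basis of W. Products of powers of these entries, with exponents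
    representing the coordinates of [v], lift any [v] to [S], so [subgroup_full] applies. *)
Lemma generates_unitmx (r : nat) (hr : (h <= r)%N) (g : state p h r) :
  (\matrix_(i < h) (g (widen_ord hr i)).1) \in unitmx -> g \in Vr om r.
Proof.
set M := \matrix_(i < h) _ => uM; rewrite inE; apply/generatesP => S Ssub gS.
have [S1 SV SM] := subgroupP _ Ssub.
apply: subgroup_full => // v.
pose T u := exists z, (u, z) \in S.
rewrite -[v](mulmxKV uM) mulmx_sum_row; apply: (big_ind T).
- by exists 0.
- move=> u u' [z uz] [z' uz']; eexists; exact: (SM _ _ uz uz').
move=> i _; rewrite rowK; set c := (_ *m _) _ _.
have := subgroup_hpow (val c) Ssub (gS (widen_ord hr i)).
rewrite [hpow _ _ _]surjective_pairing hpow1 -scaler_nat FpE.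
by move=> ?; eexists; eassumption.
Qed.

(** The standard basis of W followed by identities, so each coordinate functional is nonzero on
    exactly one entry. *)
Definition start (r : nat) : state p h r :=
  [ffun k : 'I_r => (\row_(j < h) (k == j :> nat)%:R, 0)].

Lemma start_generates r : (h <= r)%N -> start r \in Vr om r.
Proof.
move=> hr; apply: (generates_unitmx (hr := hr)).
set M := \matrix_(i < h) _; suff -> : M = 1%:M by exact: unitmx1.
by apply/matrixP => i j; rewrite !mxE ffunE mxE.
Qed.

(** With [e] a strict order, the first [h] vectors become a unitriangular matrix, hence a basis, so
    that any state is sent into V_r; [e] selects the triangle of the original matrix that
    survives. *)
Definition triangular (e : rel nat) (r : nat) (g : state p h r) : state p h r :=
  [ffun k : 'I_r => if (k < h)%N then
     (\row_(j < h) (if j == k :> nat then 1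
                    else if e k j then (g k).1 0 j else 0), (g k).2)
   else g k].

Lemma lower_triangular_generates r g : (h <= r)%N ->
  triangular (fun i j => j < i)%N g \in Vr om r.
Proof.
move=> hr; apply: (generates_unitmx (hr := hr)).
rewrite unitmxE det_trig ?big1 ?unitr1 //.
  by move=> i _; rewrite !mxE !ffunE /= ltn_ord mxE eqxx.
apply/is_trig_mxP => i j ij; rewrite !mxE !ffunE /= ltn_ord mxE gtn_eqF //.
by rewrite ltnNge ltnW.
Qed.

Lemma upper_triangular_generates r g : (h <= r)%N ->
  triangular ltn g \in Vr om r.
Proof.
move=> hr; apply: (generates_unitmx (hr := hr)).
rewrite unitmxE -det_tr det_trig ?big1 ?unitr1 //.
  by move=> i _; rewrite !mxE !ffunE /= ltn_ord mxE eqxx.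
apply/is_trig_mxP => i j ij; rewrite !mxE !ffunE /= ltn_ord mxE ltn_eqF //.
by rewrite ltnNge ltnW.
Qed.

(* A state is determined by its two triangular truncations together with the
   diagonal that both of them overwrite by ones. *)
Lemma card_Vr_lower r : (h <= r)%N ->
  (p ^ (h.+1 * r) <= #|Vr om r| ^ 2 * p ^ h)%N.
Proof.
move=> hr.
pose D : {set state p h r * state p h r * 'rV['F_p]_h} :=
  setX (setX (Vr om r) (Vr om r)) setT.
pose F (g : state p h r) := (triangular (fun i j => j < i)%N g, triangular ltn g,
  \row_(j < h) (g (widen_ord hr j)).1 0 j).
have Finj : injective F.
  move=> g g' [/ffunP eL /ffunP eU /rowP eD]; apply/ffunP => k.
  (* For [k >= h] the truncations leave the entry intact. For [k < h] the central part survives, and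
     each coordinate off the diagonal survives in one of the two truncations. *)
  have := eL k; have := eU k; rewrite !ffunE; case: ltnP => // kh [eu _] [el e2].
  rewrite [g k]surjective_pairing [g' k]surjective_pairing e2; congr pair.
  apply/rowP => j; have [jk|nkj] := eqVneq (j : nat) k.
    have := eD j; rewrite !mxE; suff -> : widen_ord hr j = k by [].
    exact: val_inj.
  have /rowP/(_ j) := eu; have /rowP/(_ j) := el; rewrite !mxE (negbTE nkj).
  by case: ltngtP nkj.
have -> : (p ^ (h.+1 * r) = #|{: state p h r}|)%N.
  by rewrite card_ffun card_prod card_mx card_Fp // card_ord mul1n -expnSr expnM.
have -> : (#|Vr om r| ^ 2 * p ^ h = #|D|)%N.
  by rewrite !cardsX cardsT card_mx card_Fp // mul1n mulnn.
rewrite -(card_codom Finj); apply: subset_leq_card; apply/subsetP => _ /codomP[g ->].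
by rewrite !in_setX in_setT /= lower_triangular_generates // upper_triangular_generates.
Qed.

End Heisenberg.

(** * The kernel as an averaging operator, and the support of its powers *)

Section Walk.
Variables (p h : nat) (om : 'rV['F_p]_h -> 'rV['F_p]_h -> 'F_p).
Hypotheses (om_symp : symplectic_form om) (p_pr : prime p).
Variables (r : nat) (r_gt1 : (1 < r)%N).

Notation R := Rdefinitions.R.
Notation state := (state p h r).
Notation P := (@Pker p h om r).
Notation Q := (@Qker p h om r).
Notation Qt := (@Qpow p h om r).

Let norm : R := (2 * p%:R * r%:R * (r%:R - 1))^-1.

Let p_gt0 : 0 < p%:R :> R.
Proof. by rewrite ltr0n prime_gt0. Qed.

Let r_gt0 : 0 < r%:R :> R.
Proof. by rewrite ltr0n ltnW. Qed.

Let r1_gt0 : 0 < r%:R - 1 :> R.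
Proof. by rewrite subr_gt0 ltr1n. Qed.

Let norm_gt0 : 0 < norm.
Proof. by rewrite invr_gt0 !mulr_gt0 // ltr0n. Qed.

(* The definitions mix the operations of Stdlib's reals with those of the ring
   structure on them; the next four equations settle on the latter. *)
Lemma PkerE x y : P x y = norm *
  \sum_(i : 'I_r) \sum_(j : 'I_r | j != i) \sum_(a : 'F_p)
     ((TR om j i a x == y)%:R + (TL om j i a x == y)%:R).
Proof. by rewrite /Pker RmultE. Qed.

Lemma QkerE x y : Q x y = 2^-1 * ((x == y)%:R + P x y) :> R.
Proof. by rewrite /Qker RmultE RplusE. Qed.

Lemma piVE (y : state) : piV om y = (y \in Vr om r)%:R / #|Vr om r|%:R :> R.
Proof. by rewrite /piV RdivE. Qed.

Lemma tvE (mu nu : state -> R) :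
  tv mu nu = 2^-1 * \sum_y `|mu y - nu y| :> R.
Proof. by rewrite /tv RmultE. Qed.

Lemma sum_delta (z : state) (F : state -> R) :
  \sum_y (z == y)%:R * F y = F z.
Proof.
rewrite (bigD1 z) //= eqxx mul1r big1 ?addr0 // => y /negbTE.
by rewrite eq_sym => ->; rewrite mul0r.
Qed.

Lemma sum_Pker z (F : state -> R) :
  \sum_y P z y * F y = norm * \sum_(i : 'I_r) \sum_(j : 'I_r | j != i)
     \sum_(a : 'F_p) (F (TR om j i a z) + F (TL om j i a z)).
Proof.
under eq_bigr do rewrite PkerE -mulrA; rewrite -mulr_sumr; congr (_ * _).
under eq_bigr do rewrite mulr_suml; rewrite exchange_big; apply: eq_bigr => i _.
under eq_bigr do rewrite mulr_suml; rewrite exchange_big; apply: eq_bigr => j _.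
under eq_bigr do rewrite mulr_suml; rewrite exchange_big; apply: eq_bigr => a _.
by under eq_bigr do rewrite mulrDl; rewrite big_split /= !sum_delta.
Qed.

Lemma sum_Qker z (F : state -> R) :
  \sum_y Q z y * F y = 2^-1 * (F z + \sum_y P z y * F y).
Proof.
under eq_bigr do rewrite QkerE -mulrA mulrDl; rewrite -mulr_sumr big_split /=.
by rewrite sum_delta.
Qed.

Lemma sum_QpowS t x (F : state -> R) :
  \sum_y Qt t.+1 x y * F y = \sum_z Qt t x z * \sum_y Q z y * F y.
Proof.
under eq_bigr do rewrite /= mulr_suml.
rewrite exchange_big; apply: eq_bigr => z _.
by rewrite mulr_sumr; apply: eq_bigr => y _; rewrite mulrA.
Qed.

Lemma Pker_ge0 x y : 0 <= P x y.
Proof.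
rewrite PkerE mulr_ge0 ?(ltW norm_gt0) //.
do 3 (apply: sumr_ge0 => ? _); by rewrite addr_ge0.
Qed.

Lemma Qker_ge0 x y : 0 <= Q x y.
Proof. by rewrite QkerE mulr_ge0 ?invr_ge0 ?addr_ge0 ?Pker_ge0. Qed.

Lemma Qpow_ge0 t x y : 0 <= Qt t x y.
Proof.
elim: t y => [|t IHt] y //=.
by apply: sumr_ge0 => z _; rewrite mulr_ge0 ?Qker_ge0.
Qed.

Lemma sumr_neq_const (i : 'I_r) (c : R) :
  \sum_(j : 'I_r | j != i) c = c * (r%:R - 1).
Proof.
rewrite sumr_const cardC1 card_ord -[_ *+ r.-1]mulr_natr.
by rewrite -subn1 natrB // ltnW.
Qed.

Lemma sum_Pker1 z : \sum_y P z y = 1.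
Proof.
under eq_bigr do rewrite -[P _ _]mulr1.
rewrite (sum_Pker z (fun=> 1)).
under eq_bigr do under eq_bigr do rewrite sumr_const card_Fp //.
under eq_bigr do rewrite sumr_neq_const.
rewrite sumr_const card_ord -[_ *+ r]mulr_natr -[(1 + 1) *+ p]mulr_natr.
rewrite /norm; field.
by rewrite !gt_eqF.
Qed.

Lemma sum_Qpow1 t x : \sum_y Qt t x y = 1.
Proof.
elim: t => [|t IHt].
  by under eq_bigr do rewrite /= -[_%:R]mulr1; rewrite (sum_delta x (fun=> 1)).
under eq_bigr do rewrite -[Qpow _ _ _ _]mulr1.
rewrite (sum_QpowS t x (fun=> 1)) -[RHS]IHt; apply: eq_bigr => z _.
rewrite (sum_Qker z (fun=> 1)); under eq_bigr do rewrite mulr1.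
by rewrite sum_Pker1 mulVf ?mulr1 // pnatr_eq0.
Qed.

(** Equal masses allow [F] to be replaced by [F - 1/2], of absolute value at most 1/2; this is the
    factor 1/2 in [tv]. *)
Lemma tv_expectation (mu nu : state -> R) (F : state -> R) :
  \sum_y mu y = \sum_y nu y -> (forall y, 0 <= F y <= 1) ->
  \sum_y nu y * F y <= \sum_y mu y * F y + tv mu nu.
Proof.
move=> mass F01; rewrite -lerBlDl -sumrB tvE mulr_sumr.
have -> : \sum_y (nu y * F y - mu y * F y) =
          \sum_y (nu y - mu y) * (F y - 2^-1).
  apply/eqP; rewrite -subr_eq0 -sumrB.
  rewrite (eq_bigr (fun y => 2^-1 * (nu y - mu y))) => [|y _]; last by ring.
  by rewrite -mulr_sumr sumrB mass subrr mulr0.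
apply: ler_sum => y _; apply: le_trans (ler_norm _) _.
rewrite normrM distrC mulrC ler_wpM2r // ler_norml.
by have /andP[? ?] := F01 y; apply/andP; split; lra.
Qed.

(** Pairs with equal indices are kept: this only enlarges the set, and it makes the count a plain
    product. *)
Definition moves (g : state) : {set state} :=
  [set (if x.2 then TR om x.1.1.1 x.1.1.2 x.1.2 g
        else TL om x.1.1.1 x.1.1.2 x.1.2 g)
     | x in {: 'I_r * 'I_r * 'F_p * bool}].

Lemma card_moves g : (#|moves g| <= 2 * p * r ^ 2)%N.
Proof.
apply: leq_trans (leq_imset_card _ _) _.
rewrite !card_prod card_Fp // !card_ord card_bool; nia.
Qed.

Lemma Qker_moves g y : y \notin moves g -> Q g y = 0.
Proof.
move=> ym; have nT (x : 'I_r * 'I_r * 'F_p * bool) :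
    (if x.2 then TR om x.1.1.1 x.1.1.2 x.1.2 g
     else TL om x.1.1.1 x.1.1.2 x.1.2 g) == y = false.
  by apply: contraNF ym => /eqP <-; apply: imset_f.
have gy : (g == y) = false.
  (* The lazy step is itself a move, with exponent 0, so [g] belongs to [moves g]. *)
  pose i0 : 'I_r := Ordinal (ltnW r_gt1).
  rewrite -(nT (i0, i0, 0, true)) /=; congr (_ == _).
  by apply/ffunP => k; rewrite ffunE; case: eqP => // ->; rewrite /= hmulxx1.
rewrite QkerE gy add0r PkerE big1 ?mulr0 // => i _.
rewrite big1 // => j _; rewrite big1 // => a _.
by rewrite (nT (j, i, a, true)) (nT (j, i, a, false)) addr0.
Qed.

Definition Qsupp t x : {set state} := [set y | Qt t x y != 0].

Lemma card_Qsupp t x : (#|Qsupp t x| <= (2 * p * r ^ 2) ^ t)%N.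
Proof.
elim: t => [|t IHt].
  apply: (@leq_trans #|[set x]|); last by rewrite cards1.
  apply: subset_leq_card; apply/subsetP => y.
  by rewrite !inE /= pnatr_eq0 eqb0 negbK eq_sym.
have sub : Qsupp t.+1 x \subset \bigcup_(z in Qsupp t x) moves z.
  apply/subsetP => y; rewrite inE /=; apply: contraR => /bigcupP yN.
  apply/eqP; apply: big1 => z _; have [->|Qz] := eqVneq (Qt t x z) 0.
    by rewrite mul0r.
  rewrite Qker_moves ?mulr0 //; apply/negP => yz; apply: yN.
  by exists z => //; rewrite inE.
apply: leq_trans (subset_leq_card sub) _.
apply: (@leq_trans (\sum_(z in Qsupp t x) #|moves z|)%N).
  apply: (big_ind2 (fun (A : {set state}) n => #|A| <= n)%N) => [|A m B n Am Bn|//].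
    by rewrite cards0.
  exact: leq_trans (leq_card_setU A B) (leq_add Am Bn).
apply: (@leq_trans (\sum_(z in Qsupp t x) 2 * p * r ^ 2)%N).
  by apply: leq_sum => z _; exact: card_moves.
by rewrite sum_nat_const [leqRHS]expnSr leq_mul2r IHt orbT.
Qed.

Lemma sum_piV (F : state -> R) :
  \sum_(y : state) piV om y * F y = (\sum_(y in Vr om r) F y) / #|Vr om r|%:R.
Proof.
rewrite mulr_suml [RHS]big_mkcond; apply: eq_bigr => y _.
by rewrite piVE; case: ifP => _; rewrite ?mul1r ?mul0r // mulrC.
Qed.

Lemma sum_piV1 : (0 < #|Vr om r|)%N -> \sum_(y : state) piV om y = 1.
Proof.
move=> V0; under eq_bigr do rewrite -[piV _ _]mulr1.
rewrite (sum_piV (fun=> 1)) sumr_const divff // pnatr_eq0; lia.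
Qed.

Lemma mixed_expectation t x (F : state -> R) :
  mixed_at om r t -> x \in Vr om r -> (forall y, 0 <= F y <= 1) ->
  (\sum_(y in Vr om r) F y) / #|Vr om r|%:R <= \sum_y Qt t x y * F y + 4^-1.
Proof.
move=> mix xV F01; have V0 : (0 < #|Vr om r|)%N by apply/card_gt0P; exists x.
rewrite -sum_piV; apply: le_trans (tv_expectation (mu := Qt t x) _ F01) _.
  by rewrite sum_Qpow1 sum_piV1.
by rewrite lerD2l; exact: mix.
Qed.

(** The test function is the indicator of the complement of the support of Q^t(x, .). Its mean under
    Q^t is 0, so at most a quarter of V_r lies outside the support. *)
Lemma mixed_card t x : mixed_at om r t -> x \in Vr om r ->
  (#|Vr om r| <= 2 * (2 * p * r ^ 2) ^ t)%N.
Proof.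
move=> mix xV; have V0 : (0 < #|Vr om r|)%N by apply/card_gt0P; exists x.
pose F y : R := (y \notin Qsupp t x)%:R.
have F01 y : 0 <= F y <= 1 by rewrite /F; case: (_ \notin _); rewrite ?lexx ?ler01.
have := mixed_expectation mix xV F01.
rewrite [X in X + _]big1 => [|y _]; last first.
  by rewrite /F inE negbK; case: eqP => [->|_]; rewrite ?mul0r ?mulr0.
rewrite add0r /F -natr_sum -big_mkcondr sum1_card ler_pdivrMr ?ltr0n // => le.
have : (4 * #|[pred y in Vr om r | y \notin Qsupp t x]| <= #|Vr om r|)%N.
  by rewrite -(ler_nat R) natrM; lra.
have -> : #|[pred y in Vr om r | y \notin Qsupp t x]| = #|Vr om r :\: Qsupp t x|.
  by apply: eq_card => y; rewrite !inE andbC.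
have := cardsID (Qsupp t x) (Vr om r).
have := subset_leq_card (subsetIr (Vr om r) (Qsupp t x)).
have := card_Qsupp t x; lia.
Qed.

End Walk.

(** * Growth of the number of active entries, and its mean under the uniform measure *)

Section Weight.
Variables (p h : nat) (om : 'rV['F_p]_h -> 'rV['F_p]_h -> 'F_p).
Hypotheses (om_symp : symplectic_form om) (p_pr : prime p) (p_odd : odd p).
Variables (r : nat) (r_gt1 : (1 < r)%N) (i0 : 'I_h).

Notation R := Rdefinitions.R.
Notation state := (state p h r).
Notation Q := (@Qker p h om r).
Notation Qt := (@Qpow p h om r).

Definition active (g : state) (i : 'I_r) : bool := (g i).1 0 i0 != 0.

Definition weight (g : state) : R := \sum_i (active g i)%:R.

Lemma weight_ge0 g : 0 <= weight g.
Proof. exact: sumr_ge0. Qed.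

Lemma weight_le g : weight g <= r%:R.
Proof.
apply: (@le_trans _ _ (\sum_(i < r) 1)); last by rewrite sumr_const card_ord.
by apply: ler_sum => i _; case: (active g i).
Qed.

Lemma weight_update (g g' : state) i j : (forall k, k != i -> g' k = g k) ->
  (active g' i -> active g i || active g j) ->
  weight g' <= weight g + (active g j)%:R.
Proof.
move=> eqg act; rewrite /weight (bigD1 i) //= [in leRHS](bigD1 i) //=.
rewrite (eq_bigr (fun k => (active g k)%:R)) => [|k ki]; last first.
  by rewrite /active eqg.
rewrite addrAC lerD2r -natrD ler_nat.
by move: act; case: active => //= /(_ isT); case: active; case: active.
Qed.

Lemma weight_TR g i j a : weight (TR om j i a g) <= weight g + (active g j)%:R.
Proof.
apply: (@weight_update _ _ i) => [k /negbTE ki|]; first by rewrite ffunE ki.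
rewrite /active ffunE eqxx /= mxE hpow1 mulmxnE.
by apply: contraLR; rewrite negb_or !negbK => /andP[/eqP-> /eqP->]; rewrite mul0rn addr0.
Qed.

Lemma weight_TL g i j a : weight (TL om j i a g) <= weight g + (active g j)%:R.
Proof.
apply: (@weight_update _ _ i) => [k /negbTE ki|]; first by rewrite ffunE ki.
rewrite /active ffunE eqxx /= mxE hpow1 mulmxnE.
by apply: contraLR; rewrite negb_or !negbK => /andP[/eqP-> /eqP->]; rewrite mul0rn addr0.
Qed.

Let p_gt0 : 0 < p%:R :> R.
Proof. by rewrite ltr0n prime_gt0. Qed.

Let r_gt0 : 0 < r%:R :> R.
Proof. by rewrite ltr0n ltnW. Qed.

Let r1_gt0 : 0 < r%:R - 1 :> R.
Proof. by rewrite subr_gt0 ltr1n. Qed.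

(** Each active [j] is the source for [r - 1] targets [i], with [2p] moves each. The total gain is
    thus at most [2p(r-1)] times the weight, out of [2pr(r-1)] moves. *)
Lemma sum_Pker_weight z :
  \sum_y Pker om z y * weight y <= (1 + r%:R^-1) * weight z.
Proof.
rewrite sum_Pker //.
rewrite ler_pdivrMl; last by rewrite !mulr_gt0 // ltr0n.
apply: (@le_trans _ _ (\sum_(i : 'I_r) \sum_(j : 'I_r | j != i)
    (2 * p%:R * weight z + 2 * p%:R * (active z j)%:R))).
  apply: ler_sum => i _; apply: ler_sum => j _.
  have -> : 2 * p%:R * weight z + 2 * p%:R * (active z j)%:R =
      \sum_(a : 'F_p) (2 * (weight z + (active z j)%:R)) :> R.
    by rewrite sumr_const card_Fp // -[RHS]mulr_natr; ring.
  apply: ler_sum => a _; have := weight_TR z i j a; have := weight_TL z i j a.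
  lra.
under eq_bigr do rewrite big_split /= sumr_neq_const //.
rewrite big_split /= sumr_const card_ord (exchange_big_dep predT) //=.
under [X in _ + X <= _]eq_bigr => j _.
  under eq_bigl do rewrite eq_sym.
  rewrite sumr_neq_const // -mulrA [X in _ * X]mulrC mulrA.
  over.
rewrite -mulr_sumr -/(weight z) -[_ *+ r]mulr_natr.
rewrite le_eqVlt; apply/orP; left; apply/eqP; field.
by rewrite gt_eqF.
Qed.

(** The lazy half keeps the weight, so the growth rate [1/r] of P becomes [1/(2r)] for Q. *)
Lemma sum_Qpow_weight t x :
  \sum_y Qt t x y * weight y <= (1 + (2 * r%:R)^-1) ^+ t * weight x.
Proof.
elim: t => [|t IHt]; first by rewrite expr0 mul1r /= sum_delta.
rewrite sum_QpowS.
apply: (@le_trans _ _ (\sum_z Qt t x z * ((1 + (2 * r%:R)^-1) * weight z))).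
  apply: ler_sum => z _; apply: ler_wpM2l; first exact: Qpow_ge0.
  rewrite sum_Qker invfM; have := sum_Pker_weight z; lra.
under eq_bigr do rewrite mulrCA.
rewrite -mulr_sumr exprS -mulrA ler_wpM2l // addr_ge0 // invr_ge0.
by rewrite mulr_ge0 ?ltW.
Qed.

Lemma weight_start : (h <= r)%N -> weight (start p h r) = 1.
Proof.
move=> hr; rewrite /weight (bigD1 (widen_ord hr i0)) //= big1 ?addr0.
  by rewrite /active ffunE mxE /= eqxx oner_eq0.
move=> k; rewrite /active ffunE mxE /= -val_eqE /= => /negbTE ->.
by rewrite eqxx.
Qed.

(** Otherwise all entries would lie in the proper subgroup where coordinate [i0] vanishes. *)
Lemma generates_active g i : g \in Vr om r -> ~~ active g i ->
  exists2 j, j != i & active g j.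
Proof.
rewrite inE => /generatesP gen gi.
have [/existsP[j /andP[ji gj]]|] := boolP [exists j, (j != i) && active g j].
  by exists j.
rewrite negb_exists => /forallP inactive.
pose S : {set Heis p h} := [set x : Heis p h | x.1 0 i0 == 0].
have : (const_mx 1, 0) \in S; last by rewrite inE /= mxE oner_eq0.
rewrite (gen S) ?inE //; last first.
  move=> j; rewrite inE; have := inactive j.
  by have [-> _|_ /=] := eqVneq j i; rewrite -[_ == 0]negbK.
apply/subgroupP; split; first by rewrite inE mxE.
  by move=> x; rewrite !inE mxE oppr_eq0.
by move=> x y; rewrite !inE mxE => /eqP -> /eqP ->; rewrite addr0.
Qed.

(* The selected entry [g j] is not modified, so [activate i] can be undone; it
   therefore matches the inactive states at [i] with distinct active ones. *)
Definition activate (i : 'I_r) (g : state) : state :=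
  [ffun k => if k == i then
     hmul om (g i) (if [pick j | (j != i) && active g j] is Some j
                    then g j else hone p h)
   else g k].

Lemma activate_inj i : injective (activate i).
Proof.
move=> g g' /ffunP eqg.
have eqk k : k != i -> g k = g' k.
  by move=> /negbTE ki; have := eqg k; rewrite !ffunE ki.
(* The choice and the chosen entry depend only on indices other than [i], where [g] and [g'] agree.
   Hence both entries at [i] were multiplied on the right by the same element, which can be
   cancelled. *)
have eqp : [pick j | (j != i) && active g j] = [pick j | (j != i) && active g' j].
  by apply: eq_pick => j /=; case: eqVneq => //= ji; rewrite /active eqk.
apply/ffunP => k; have [->|/eqk//] := eqVneq k i.
have := eqg i; rewrite !ffunE eqxx -eqp.
have -> : (if [pick j | (j != i) && active g j] is Some j then g j else hone p h)
        = (if [pick j | (j != i) && active g j] is Some j then g' j else hone p h).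
  by case: pickP => // j /andP[/eqk].
set y := if _ is Some _ then _ else _.
by move/(congr1 (fun x => hmul om x (hinv y))); rewrite !hmulK.
Qed.

Lemma activate_generates i g : g \in Vr om r -> activate i g \in Vr om r.
Proof.
rewrite !inE => /generatesP gen; apply/generatesP => S Ssub aS; apply: gen => // k.
have [S1 SV SM] := subgroupP _ _ Ssub.
have kS j : j != i -> g j \in S.
  by move=> /negbTE ji; have := aS j; rewrite ffunE ji.
have [->|/kS//] := eqVneq k i.
have := aS i; rewrite ffunE eqxx; set y := (if _ is Some _ then _ else _).
have yS : y \in S by rewrite /y; case: pickP => // j /andP[/kS].
by move=> /SM /(_ (SV _ yS)); rewrite hmulK.
Qed.

Lemma activate_active i g : g \in Vr om r -> ~~ active g i ->
  active (activate i g) i.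
Proof.
move=> gV gi; rewrite /active ffunE eqxx /= mxE; move: (gi); rewrite negbK => /eqP ->.
case: pickP => [j /andP[_ gj]|none]; first by rewrite add0r.
by have [j ji gj] := generates_active gV gi; have := none j; rewrite ji gj.
Qed.

(** For each [i], [activate i] injects the states of V_r inactive at [i] into those active there, so
    at least half of V_r is active at [i]. *)
Lemma sum_weight_ge : r%:R / 2 * #|Vr om r|%:R <= \sum_(g in Vr om r) weight g.
Proof.
rewrite exchange_big /=.
have -> : r%:R / 2 * #|Vr om r|%:R = \sum_(i < r) #|Vr om r|%:R / 2 :> R.
  by rewrite sumr_const card_ord -[RHS]mulr_natr; ring.
apply: ler_sum => i _.
rewrite -natr_sum -big_mkcondr sum1_card ler_pdivrMr ?ltr0n //.
rewrite -natrM ler_nat.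
pose A := [set g in Vr om r | active g i].
have -> : #|[pred g in Vr om r | active g i]| = #|A|.
  by apply: eq_card => g; rewrite !inE.
have sub : activate i @: (Vr om r :\: A) \subset A.
  apply/subsetP => _ /imsetP[g /setDP[gV gA] ->].
  rewrite inE activate_generates ?activate_active //.
  by apply: contra gA => gi; rewrite inE gV.
have := subset_leq_card sub; rewrite card_imset; last exact: activate_inj.
rewrite -(cardsID A (Vr om r)) muln2 -addnn => ?.
by rewrite leq_add // subset_leq_card ?subsetIr.
Qed.

(** The test function is [weight / r]. Its uniform mean is at least 1/2, so at a mixed time its mean
    from [start] is at least 1/4. *)
Lemma mixed_weight t : (h <= r)%N -> mixed_at om r t ->
  r%:R <= 4 * (1 + (2 * r%:R)^-1) ^+ t :> R.
Proof.
move=> hr mix; have h_gt0 : (0 < h)%N by apply: leq_trans (ltn_ord i0).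
have xV : start p h r \in Vr om r by exact: start_generates.
have V_gt0 : 0 < #|Vr om r|%:R :> R.
  by rewrite ltr0n; apply/card_gt0P; exists (start p h r).
have F01 g : 0 <= weight g / r%:R <= 1.
  apply/andP; split; first by rewrite divr_ge0 ?weight_ge0.
  by rewrite ler_pdivrMr // mul1r weight_le.
have := mixed_expectation p_pr r_gt1 mix xV F01.
under [X in _ <= X + _]eq_bigr do rewrite mulrA.
rewrite -!mulr_suml; have := sum_Qpow_weight t (start p h r).
rewrite weight_start // mulr1.
set E := \sum_y _; set q := _ ^+ t => Eq le.
have half : 2^-1 <= (\sum_(g in Vr om r) weight g) / r%:R / #|Vr om r|%:R.
  rewrite !ler_pdivlMr //; apply: le_trans sum_weight_ge.
  by rewrite mulrAC [2^-1 * _]mulrC.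
have : 4^-1 <= E / r%:R by lra.
by rewrite ler_pdivlMr //; lra.
Qed.

End Weight.

(** * The counting bound as an inequality between powers *)

Lemma mixed_pow p m (om : 'rV['F_p]_(2 * m) -> 'rV['F_p]_(2 * m) -> 'F_p) r t :
  prime p -> odd p -> symplectic_form om -> (0 < m)%N -> (2 * m + 1 <= r)%N ->
  (4 <= r)%N -> (2 * p <= r)%N -> mixed_at om r t ->
  (p ^ (r * (2 * m).+1) <= r ^ (12 * t))%N.
Proof.
move=> p_pr p_odd om_symp m_gt0 hr r4 pr mix; set h := (2 * m)%N in om om_symp mix hr *.
have h_gt0 : (0 < h)%N by rewrite /h; lia.
have h_le_r : (h <= r)%N by lia.
have p_gt2 : (2 < p)%N by exact: odd_prime_gt2.
have r_gt1 : (1 < r)%N by lia.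
have Vlow := card_Vr_lower om_symp p_pr p_odd h_gt0 h_le_r.
have xV := start_generates om_symp p_pr p_odd h_gt0 h_le_r.
have Vup := mixed_card om_symp p_pr r_gt1 mix xV.
(* The condition [2p <= r] absorbs [p] into a power of [r], so that the time bound has a constant
   independent of [p]. *)
have Kr : (2 * p * r ^ 2 <= r ^ 3)%N by rewrite [leqRHS]expnS leq_mul2r pr orbT.
have {Vup}Vup : (#|Vr om r| ^ 2 <= p ^ 2 * r ^ (6 * t))%N.
  apply: (@leq_trans ((2 * (r ^ 3) ^ t) ^ 2)%N).
    by rewrite leq_exp2r // (leq_trans Vup) // leq_mul2l; case: (t) => // t'; rewrite leq_exp2r.
  rewrite expnMn leq_mul //; first by rewrite leq_exp2r // ltnW.
  by rewrite -!expnM leq_pexp2l //; lia.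
(* The exponent loses [h] to the diagonal in [card_Vr_lower] and 2 to the factor
   [2 ^ 2 <= p ^ 2]. *)
have small : (p ^ (h.+1 * r - h.+2) <= r ^ (6 * t))%N.
  rewrite -(@leq_pmul2l (p ^ h.+2)%N) ?expn_gt0 ?prime_gt0 // -expnD.
  rewrite subnKC; last by nia.
  have -> : (p ^ h.+2 * r ^ (6 * t) = p ^ 2 * r ^ (6 * t) * p ^ h)%N.
    by rewrite -addn2 expnD -mulnA mulnC.
  by apply: leq_trans Vlow _; rewrite leq_mul2r Vup orbT.
have -> : (12 * t = 6 * t * 2)%N by lia.
(* Squaring recovers the full exponent: for [r >= 4] the loss [h + 2] is at most half of
   [(h + 1) r]. *)
rewrite [leqRHS]expnM; apply: (@leq_trans ((p ^ (h.+1 * r - h.+2)) ^ 2)%N).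
  by rewrite -expnM leq_pexp2l ?prime_gt0 //; nia.
by rewrite leq_exp2r.
Qed.

(* Logarithms of the two bounds, and the conclusion *)
From Stdlib Require Import Reals Lra.

Local Close Scope ring_scope.

Lemma ln_le_mono (x y : R) : (0 < x -> x <= y -> ln x <= ln y)%R.
Proof.
move=> x0 /Rle_lt_or_eq_dec [xy|->]; last exact: Rle_refl.
exact/Rlt_le/ln_increasing.
Qed.

Lemma ln_1plus_le (x : R) : (0 <= x -> ln (1 + x) <= x)%R.
Proof.
move=> x0; rewrite -[X in (_ <= X)%R]ln_exp.
by apply: ln_le_mono; [Lra.lra | exact: exp_ineq1_le].
Qed.

(** Logarithms give [ln r <= ln 4 + t/(2r)]. From [r >= 16] on, [ln 4] is at most half of [ln r], so
    the other half is at most [t/(2r)]. *)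
Lemma rlogr_le_time (r t : nat) : (16 <= r)%N ->
  (INR r <= 4 * (1 + / (2 * INR r)) ^ t)%R -> (INR r * ln (INR r) <= INR t)%R.
Proof.
move=> r16 le.
have {r16}r16 : (16 <= INR r)%R.
  by have /ssrnat.leP/le_INR := r16; rewrite [INR 16]INR_IZR_INZ.
have inv_gt0 : (0 < / (2 * INR r))%R by apply: Rinv_0_lt_compat; Lra.lra.
have pow_gt0 : (0 < (1 + / (2 * INR r)) ^ t)%R by apply: pow_lt; Lra.lra.
have := ln_le_mono _ le; rewrite ln_mult; [|Lra.lra|by []].
rewrite ln_pow; last by Lra.lra.
move=> /(_ ltac:(Lra.lra)) le1.
have ln16 : (2 * ln 4 <= ln (INR r))%R.
  have -> : (2 * ln 4 = ln 16)%R.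
    have -> : (16 = 4 * 4)%R by Lra.lra.
    by rewrite ln_mult; Lra.lra.
  by apply: ln_le_mono; Lra.lra.
have le2 : (INR t * ln (1 + / (2 * INR r)) <= INR t * / (2 * INR r))%R.
  apply: Rmult_le_compat_l; first exact: pos_INR.
  by apply: ln_1plus_le; Lra.lra.
have : (ln (INR r) * / 2 <= INR t * / (2 * INR r))%R by Lra.lra.
move/(Rmult_le_compat_l (2 * INR r) _ _ ltac:(Lra.lra)).
have -> : (2 * INR r * (ln (INR r) * / 2) = INR r * ln (INR r))%R by Lra.lra.
by rewrite (Rmult_comm (INR t)) -Rmult_assoc Rinv_r ?Rmult_1_l //; Lra.lra.
Qed.

Lemma INR_expn (m n : nat) : INR (expn m n) = (INR m ^ n)%R.
Proof. by elim: n => [|n IHn] //; rewrite expnS -multE mult_INR IHn. Qed.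

Lemma ln_ge1 (p : nat) : (2 < p)%N -> (1 <= ln (INR p))%R.
Proof.
move=> /ssrnat.leP/le_INR p3; rewrite -[X in (X <= _)%R](ln_exp 1).
apply: ln_le_mono; first exact: exp_pos.
by have := exp_le_3; rewrite [INR 3]INR_IZR_INZ /= in p3; Lra.lra.
Qed.

(** Logarithms give [r (h+1) ln p <= 12 t ln r]. Here [ln p >= 1] because [p >= 3 >= e], and [ln r]
    is at most [1 + ln r = ln (e r)]. *)
Lemma pow_le_time (p r h t : nat) : (2 < p)%N -> (1 < r)%N ->
  (expn p (r * h.+1) <= expn r (12 * t))%N ->
  (INR r * (INR h + 1) / ln (exp 1 * INR r) <= 12 * INR t)%R.
Proof.
move=> p2 r1 /ssrnat.leP/le_INR.
have r0 : (0 < INR r)%R by apply: lt_0_INR; apply/ssrnat.ltP; exact: ltnW.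
have p0 : (0 < INR p)%R by apply: lt_0_INR; apply/ssrnat.ltP; exact: ltnW (ltnW p2).
have lnr : (0 <= ln (INR r))%R.
  by rewrite -ln_1; apply: ln_le_mono; [Lra.lra | apply: (le_INR 1); apply/ssrnat.leP; exact: ltnW].
rewrite !INR_expn => /(ln_le_mono (pow_lt _ _ p0)).
rewrite !ln_pow // -!multE !mult_INR S_INR.
rewrite ln_mult ?ln_exp //; last exact: exp_pos.
have -> : INR 12 = 12%R by rewrite INR_IZR_INZ.
have := ln_ge1 p2; have := pos_INR t; have := pos_INR h.
set a := INR h; set b := INR t; set L := ln (INR p); set l := ln (INR r) in lnr * => a0 b0 L1 le.
apply: (Rmult_le_reg_r (1 + l)); first by Lra.lra.
rewrite /Rdiv Rmult_assoc Rinv_l ?Rmult_1_r; last by Lra.lra.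
have X0 : (0 <= INR r * (a + 1))%R by apply: Rmult_le_pos; Lra.lra.
by have := Rmult_le_compat_l _ _ _ X0 L1; Lra.lra.
Qed.

Theorem theorem4p3 (p : nat) (hp : prime p) (hodd : odd p) :
  exists (c : R) (r0 : nat), (0 < c)%R /\
  forall (m : nat) (om : 'rV['F_p]_(2 * m) -> 'rV['F_p]_(2 * m) -> 'F_p),
    (1 <= m)%N -> symplectic_form om ->
  forall r : nat, (2 * m + 1 <= r)%N -> (r0 <= r)%N ->
  forall t : nat, mixed_at om r t ->
    (c * Rmax (INR r * ln (INR r))
              (INR r * (INR (2 * m) + 1) / ln (exp 1 * INR r)) <= INR t)%R.
Proof.
(* The 12 is the exponent factor in [mixed_pow]; the [r log r] bound holds even with constant 1. The
   threshold 16 serves [rlogr_le_time], and [2 * p] serves [mixed_pow]. *)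
exists (/ 12)%R, (maxn 16 (2 * p)); split; first by Lra.lra.
move=> m om m_gt0 om_symp r hr; rewrite geq_max => /andP[r16 pr] t mix.
have p_gt2 := odd_prime_gt2 hodd hp.
have r_gt1 : (1 < r)%N by exact: leq_trans r16.
have h_gt0 : (0 < 2 * m)%N by rewrite muln_gt0.
have h_le_r : (2 * m <= r)%N by apply: leq_trans hr; rewrite addn1.
have t0 := pos_INR t.
suff : (Rmax (INR r * ln (INR r))
  (INR r * (INR (2 * m) + 1) / ln (exp 1 * INR r)) <= 12 * INR t)%R by Lra.lra.
apply: Rmax_lub.
  have le := mixed_weight om_symp hp hodd r_gt1 (Ordinal h_gt0) h_le_r mix.
  suff : (INR r * ln (INR r) <= INR t)%R by Lra.lra.
  by apply: rlogr_le_time => //; apply/RleP; rewrite !RealsE.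
apply: (pow_le_time p_gt2 r_gt1).
apply: (mixed_pow hp hodd om_symp) => //; exact: leq_trans r16.
Qed.
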